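(* Let $n\geq 1$ be an integer. The number of permutations $\pi\in\mathfrak{S}_n$ that avoid $321$ as a consecutive pattern and satisfy $\operatorname{ilpk}(\pi)=1$ (that is, such that $\pi^{-1}$ has exactly one left peak) is equal to $$\sum_{i=1}^{n-1}\sum_{k=1}^{i}f_{k-1}f_k=f_{n-1}f_n-\left\lfloor\frac{n+1}{2}\right\rfloor.$$
   Context: $\mathfrak{S}_n$ is the set of permutations of $[n]=\{1,2,\dots,n\}$, written in one-line notation $\pi=\pi_1\pi_2\cdots\pi_n$. For a sequence $w$ of $n$ distinct integers, the standardization $\operatorname{std}(w)\in\mathfrak{S}_n$ is obtained by replacing the smallest entry of $w$ with $1$, the second smallest with $2$, and so on. A permutation $\pi\in\mathfrak{S}_n$ contains $\sigma\in\mathfrak{S}_m$ as a consecutive pattern if $\operatorname{std}(\pi_i\pi_{i+1}\cdots\pi_{i+m-1})=\sigma$ for some $i\in[n-m+1]$; otherwise $\pi$ avoids $\sigma$ as a consecutive pattern (in particular $\pi$ avoids $\sigma$ whenever $n<m$). An index $i\in\{2,\dots,n-1\}$ is a peak of $\pi\in\mathfrak{S}_n$ if $\pi_{i-1}<\pi_i>\pi_{i+1}$. An index $i\in[n-1]$ is a left peak of $\pi$ if either $i$ is a peak of $\pi$, or $i=1$ and $\pi_1>\pi_2$. $\operatorname{ilpk}(\pi)$ denotes the number of left peaks of the inverse permutation $\pi^{-1}$. The Fibonacci numbers are indexed by $f_0=1$, $f_1=1$, and $f_n=f_{n-1}+f_{n-2}$ for $n\geq 2$. *)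

(* Defs.v *)
From mathcomp Require Import all_boot all_order all_algebra all_fingroup.

Set Implicit Arguments.
Unset Strict Implicit.
Unset Printing Implicit Defensive.

(* ['S_n] permutes {0, ..., n-1}: its elements are shifted to permutations
   of [n] = {1, ..., n}, so the word below has letters 1, ..., n. *)
Definition oneline n (pi : 'S_n) : seq nat := [seq (pi i).+1 | i : 'I_n].

(* [w] is meant to be free of repetitions; the k-th smallest letter is then
   the one having exactly k letters less than or equal to it. *)
Definition std (w : seq nat) : seq nat :=
  [seq count (fun y => y <= x) w | x <- w].

(* [p] and [w] are one-line notations. The starting position of the factor
   is 0-based, from 0 to [size w - size p]; the range is empty when
   [size w < size p]. *)
Definition contains_consecutive (p w : seq nat) : bool :=
  has (fun i => std (take (size p) (drop i w)) == p)
      (iota 0 ((size w).+1 - size p)).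

Definition avoids_consecutive (p w : seq nat) : bool :=
  ~~ contains_consecutive p w.

(* Letters are indexed from 1. *)
Definition letter (w : seq nat) (i : nat) : nat := nth 0 w i.-1.

Definition is_peak (w : seq nat) (i : nat) : bool :=
  [&& 2 <= i < size w, letter w i.-1 < letter w i
    & letter w i.+1 < letter w i].

Definition is_left_peak (w : seq nat) (i : nat) : bool :=
  (1 <= i < size w) &&
  (is_peak w i || (i == 1) && (letter w 2 < letter w 1)).

Definition lpk n (pi : 'S_n) : nat :=
  count (is_left_peak (oneline pi)) (iota 1 n.-1).

Definition ilpk n (pi : 'S_n) : nat := lpk pi^-1%g.

(* Indexed so that fib 0 = fib 1 = 1. *)
Fixpoint fib (n : nat) : nat :=
  match n with
  | 0 => 1
  | 1 => 1
  | (m.+1 as k).+1 => fib k + fib m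
  end.

(* Main.v *)
Require Import Defs.
From HB Require Import structures.
From mathcomp Require Import all_boot all_order all_algebra all_fingroup.
From mathcomp Require Import zify.

Set Implicit Arguments.
Unset Strict Implicit.
Unset Printing Implicit Defensive.

(** The inverse of [pi] has exactly one left peak iff its descents are the
    steps [l, ..., r] of one nonempty interval with [0 < l <= r < n]
    ([ilpk1P]).  Then the values of [pi] up to [l] occur from left to right,
    so do those above [r], and the ones in between occur from right to left.
    Colour each position by its value: [Low] up to [l], [High] above [r],
    [Mid] in between.  The resulting word determines [pi]: sorting the
    positions by colour, and within a colour from left to right, or from
    right to left for [Mid], lists them by increasing value ([word_perm],
    [word_perm_layers]).  The step [l] is a descent: the last [Low] stands to
    the right of the position that has the next value; and the step [r]
    likewise brings the first [High] to the left of the position with the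
    previous value.  So the words that occur are
      Low ... Low High u Low High ... High      ([u] arbitrary),
    i.e. those in which all the [Mid] lie between some [High] and a later
    [Low] ([sandwiched], [inv_descent_word], [word_perm_inj],
    [word_perm_onto]).

    Two adjacent letters of [pi] form a descent iff the colour goes down or
    both colours are [Mid]; hence [pi] avoids 321 iff the word has no two
    successive such falls ([word_perm_avoids]).  It remains to count the words
    with two local conditions, which is done by reading them from the left
    ([nb_words_fib]).  There are [fib k.-1 * fib k] admissible [u] of length
    [k.-1], and [n - k] choices for the lengths of the two outer blocks, which
    gives the double sum ([nb_words_sandwiched]).  Its closed form comes from
    [fib_sum_sqr], a telescoping of
    [fib k.+1 ^ 2 - fib k.-1 ^ 2 = fib k * (fib k.+1 + fib k.-1)]. *)

(** * Words over three levels *)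

Inductive level := Low | Mid | High.

Definition height x : nat := match x with Low => 0 | Mid => 1 | High => 2 end.

Definition level_of_ord (i : 'I_3) :=
  match val i with 0 => Low | 1 => Mid | _ => High end.

Lemma height_ordK : cancel (fun x => inord (height x)) level_of_ord.
Proof. by case; rewrite /level_of_ord /= inordK. Qed.

HB.instance Definition _ := Finite.copy level (can_type height_ordK).

Lemma level_eqE x y : (x == y) = (height x == height y).
Proof. by apply/eqP/eqP => [-> //|]; case: x; case: y. Qed.

(** The same recursive test serves for 321 in a permutation and for its image
    on words, with different relations [e]. *)
Fixpoint chain_free (T : Type) (e : rel T) (w : seq T) : bool :=
  if w is x :: w' then
    (if w' is y :: z :: _ then ~~ (e x y && e y z) else true) && chain_free e w'
  else true.

Lemma chain_freeP (T : Type) (e : rel T) (x0 : T) (w : seq T) :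
  reflect (forall i, i.+2 < size w ->
             ~~ (e (nth x0 w i) (nth x0 w i.+1)
                 && e (nth x0 w i.+1) (nth x0 w i.+2)))
          (chain_free e w).
Proof.
elim: w => [|x w IHw]; first by apply: ReflectT.
apply: (iffP andP) => [[wx /IHw w_free] [|i] i_lt | w_free].
- by case: w wx i_lt {IHw w_free} => [|y [|z w]].
- exact: w_free.
- split; last by apply/IHw => i; apply: (w_free i.+1).
  by case: w w_free {IHw} => [|y [|z w]] // w_free; apply: (w_free 0).
Qed.

(** The pairs of colours of adjacent positions at which [word_perm] descends:
    within the class [Mid], values decrease from left to right. *)
Definition falls : rel level := fun x y =>
  (height y < height x) || ((height x == 1) && (height y == 1)).

(** The condition left on the rest of a word once a [High] has been read: some
    [Low] comes after every [Mid]; see [closesP]. *)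
Fixpoint closes (w : seq level) : bool :=
  if w is x :: w' then closes w' || ((height x == 0) && (Mid \notin w')) else false.

Fixpoint sandwiched (w : seq level) : bool :=
  match w with
  | Low :: w' => sandwiched w'
  | High :: w' => closes w'
  | _ => false
  end.

Lemma closesP (w : seq level) :
  reflect (exists j, [/\ j < size w, nth High w j = Low
                       & forall k, k < size w -> nth High w k = Mid -> k < j])
          (closes w).
Proof.
elim: w => [|x w IHw] /=; first by apply: ReflectF => -[j []].
apply: (iffP orP) => [[/IHw[j [lt_j wj jP]] | /andP[x_low noMid]]
                     | [[|j] [lt_j /= wj jP]]].
- by exists j.+1; split=> // -[|k] //= lt_k /jP; apply.
- exists 0; split=> [//||[|k] /= lt_k wk]; first by case: x x_low.
    by rewrite wk in x_low.
  case/negP: noMid.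
  by rewrite -wk mem_nth.
- right; rewrite wj /=; apply/negP => /(nthP High)[k lt_k wk].
  by have := jP k.+1 lt_k wk.
- left; apply/IHw; exists j; split=> // k lt_k wk.
  exact: (jP k.+1 lt_k wk).
Qed.

(** The recursion takes for the left bound the first [High] that is preceded by
    [Low] only, and then looks for the right bound by [closes]. *)
Lemma sandwichedP (w : seq level) :
  reflect (exists i j, [/\ i < j < size w, nth High w i = High,
                           nth High w j = Low
                       & forall k, k < size w -> nth High w k = Mid -> i < k < j])
          (sandwiched w).
Proof.
elim: w => [|x w IHw] /=; first by apply: ReflectF => -[i [j []]]; rewrite ltn0 andbF.
case: x.
- apply: (iffP IHw) => [[i [j [lt_ij wi wj ijP]]] | [[|i] [[|j] [//= lt_ij wi wj ijP]]]].
    by exists i.+1, j.+1; split=> // -[|k] //= lt_k /ijP; apply.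
  by exists i, j; split=> // k lt_k wk; apply: (ijP k.+1).
- by apply: ReflectF => -[i [j [_ _ _ /(_ 0 isT erefl)]]].
- apply: (iffP (closesP _)) => [[j [lt_j wj jP]] | [i [[|j] [//= lt_ij _ wj ijP]]]].
    by exists 0, j.+1; split=> // -[|k] //= lt_k /jP; apply.
  exists j; split=> //; first by case/andP: lt_ij.
  by move=> k lt_k wk; case/andP: (ijP k.+1 lt_k wk).
Qed.

(** * Counting the words *)

Definition nb_words n (P : pred (seq level)) : nat :=
  #|[set t : n.-tuple level | P t]|.

Lemma nb_words_eq n (P Q : pred (seq level)) :
  P =1 Q -> nb_words n P = nb_words n Q.
Proof. by move=> eqPQ; apply: eq_card => t; rewrite !inE eqPQ. Qed.

Lemma nb_words0 (P : pred (seq level)) : nb_words 0 P = P [::].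
Proof.
rewrite /nb_words; case: (boolP (P [::])) => P0.
  rewrite (@eq_card _ _ predT) ?card_tuple // => t.
  by rewrite tuple0 !inE.
by apply: eq_card0 => t; rewrite tuple0 !inE (negPf P0).
Qed.

Lemma nb_wordsS n (P : pred (seq level)) :
  nb_words n.+1 P = nb_words n (fun w => P (Low :: w))
    + nb_words n (fun w => P (Mid :: w)) + nb_words n (fun w => P (High :: w)).
Proof.
have split_head x : nb_words n (fun w => P (x :: w))
    = #|[set t : n.+1.-tuple level | P t & thead t == x]|.
  have consI : injective (fun t : n.-tuple level => cons_tuple x t).
    by move=> s t /(congr1 val)[] /val_inj.
  rewrite /nb_words -(card_imset _ consI).
  apply: eq_card => t; rewrite inE; apply/imsetP/andP => [[s] | [Pt /eqP <-]].
    by rewrite inE => Ps ->; rewrite theadE.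
  by exists [tuple of behead t]; [rewrite inE /=; move: Pt; rewrite {1}(tuple_eta t)
    | rewrite {1}(tuple_eta t); apply: val_inj].
rewrite !split_head /nb_words.
rewrite !cardsE -!sum1_card /in_mem /=.
rewrite (bigID (fun t : n.+1.-tuple level => thead t == Low)) /= -addnA; congr (_ + _).
rewrite (bigID (fun t : n.+1.-tuple level => thead t == Mid)) /=; congr (_ + _);
  by apply: eq_bigl => t; rewrite !level_eqE; case: (thead t);
     rewrite /= ?andbT ?andbF.
Qed.

Lemma nb_words_pred0 n (P : pred (seq level)) : P =1 xpred0 -> nb_words n P = 0.
Proof. by move=> P0; apply: eq_card0 => t; rewrite inE P0. Qed.

Definition fib_sum n := \sum_(1 <= k < n.+1) fib k.-1 * fib k.

Lemma fibSS n : fib n.+2 = fib n.+1 + fib n.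
Proof. by []. Qed.

Lemma fib_sum0 : fib_sum 0 = 0.
Proof. by rewrite /fib_sum big_nil. Qed.

Lemma fib_sumS n : fib_sum n.+1 = fib_sum n + fib n * fib n.+1.
Proof. by rewrite /fib_sum big_nat_recr. Qed.

(** Two consecutive instances are needed at each step, as the identity behind
    it relates [fib n.+2 ^ 2] to [fib n ^ 2].  It also follows that
    [fib_sum n + fib_sum n.+1 + 1 = fib n ^ 2 + fib n.+1 ^ 2]. *)
Lemma fib_sum_sqr n : fib_sum n + ~~ odd n = fib n ^ 2.
Proof.
suff [] : fib_sum n + ~~ odd n = fib n ^ 2 /\
          fib_sum n.+1 + ~~ odd n.+1 = fib n.+1 ^ 2 by [].
elim: n => [|n [IH1 IH2]]; first by rewrite fib_sumS fib_sum0.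
split=> //; rewrite fib_sumS fib_sumS.
have -> : ~~ odd n.+2 = ~~ odd n by rewrite /= negbK.
rewrite fibSS; nia.
Qed.

Notation fall_free := (chain_free falls).

(** No fall starts at a [Low], and the falls from [Mid] lead to the same letters
    as those from [High].  Hence, in front of a word, [Low] can be deleted and
    [Mid] replaced by [High], which keeps the number of cases small. *)
Lemma fall_free_Low w : fall_free (Low :: w) = fall_free w.
Proof. by case: w => [|[] [|z w]]. Qed.

Lemma fall_free_Mid w : fall_free (Mid :: w) = fall_free (High :: w).
Proof. by case: w => [|[] [|z w]]. Qed.

Lemma fall_free_High2 x w :
  fall_free [:: High, x & w] =
  match x with
  | Low => fall_free w
  | Mid => if w is (Low | Mid) :: _ then false else fall_free w
  | High => fall_free (High :: w)
  end.
Proof. by case: x; case: w => [|[] [|[] w]]. Qed.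

(** The condition left on the rest of a word once a [High], and after it a
    [Low], has been read with no [Mid] since: that [Low] may be the last one. *)
Definition settled w := closes w || (Mid \notin w).

Lemma settledE x w : settled (x :: w) =
  match x with Low | High => settled w | Mid => closes w end.
Proof.
rewrite /settled /= inE negb_or level_eqE; case: x => //=; rewrite ?orbF //.
by rewrite -orbA orbb.
Qed.

Lemma closesE x w : closes (x :: w) = if x is Low then settled w else closes w.
Proof. by case: x; rewrite /settled /= ?orbF. Qed.

(** The four families are closed under removal of the first letter, so their
    sizes satisfy a linear recurrence.  The prefixes [High] and [High, Mid]
    record the letters already read, on which the next falls depend; [closes]
    and [settled] record whether a [Low] is still to come.  After
    [High, Mid] only [High] is possible, which explains the shift in the third
    size, and the sum of the third and fourth sizes is the increment of the
    first. *)
Lemma nb_words_fib n :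
  [/\ nb_words n (fun w => fall_free (High :: w) && closes w) = fib_sum n,
      nb_words n (fun w => fall_free (High :: w) && settled w) = (fib_sum n).+1,
      nb_words n (fun w => fall_free [:: High, Mid & w] && closes w)
        = fib_sum n.-1
    & nb_words n (fun w => fall_free w && settled w) + fib_sum n.-1
        = fib n * fib n.+1].
Proof.
elim: n => [|n []]; first by rewrite !nb_words0 /= fib_sum0.
set hC := fun w => fall_free (High :: w) && closes w.
set hS := fun w => fall_free (High :: w) && settled w.
set hmC := fun w => fall_free [:: High, Mid & w] && closes w.
set lS := fun w => fall_free w && settled w.
move=> hCn hSn hmCn lSn.
have -> : nb_words n.+1 hC = nb_words n lS + nb_words n hmC + nb_words n hC.
  rewrite nb_wordsS /hC /lS /hmC; congr (_ + _ + _); apply: nb_words_eq => w;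
    by rewrite ?fall_free_High2 closesE.
have -> : nb_words n.+1 hS = nb_words n lS + nb_words n hmC + nb_words n hS.
  rewrite nb_wordsS /hS /lS /hmC; congr (_ + _ + _); apply: nb_words_eq => w;
    by rewrite ?fall_free_High2 settledE.
have -> : nb_words n.+1 hmC = nb_words n hC.
  rewrite nb_wordsS -[RHS]add0n -[0]/(0 + 0) /hmC /hC.
  congr (_ + _ + _); last apply: nb_words_eq => w; last rewrite closesE.
  - by apply: nb_words_pred0 => w; rewrite fall_free_High2.
  - by apply: nb_words_pred0 => w; rewrite fall_free_High2.
  - by rewrite fall_free_High2.
have -> : nb_words n.+1 lS = nb_words n lS + nb_words n hC + nb_words n hS.
  rewrite nb_wordsS /hS /hC /lS; congr (_ + _ + _); apply: nb_words_eq => w;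
    by rewrite ?fall_free_Low ?fall_free_Mid settledE.
have fsS := fib_sumS n; rewrite hCn hSn hmCn; split; [lia | lia | by [] |].
(* The case [n = 0] is apart because of the truncated predecessor. *)
case: n fsS lSn {hCn hSn hmCn} => [|n] /=; first by rewrite fib_sum0; lia.
have := fib_sum_sqr n; have := fib_sum_sqr n.+1; rewrite fib_sumS /=.
by case: (odd n) => /=; nia.
Qed.

(** Each leading [Low] leaves the condition unchanged, so the increment from
    length [n] to [n.+1] counts the words that start with [High]. *)
Lemma nb_words_sandwiched n :
  nb_words n (fun w => fall_free w && sandwiched w) = \sum_(0 <= i < n) fib_sum i.
Proof.
elim: n => [|n IHn]; first by rewrite nb_words0 big_nil.
rewrite nb_wordsS big_nat_recr //= -IHn.
rewrite (@nb_words_pred0 n (fun w => fall_free (Mid :: w) && _)); last first.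
  by move=> w; rewrite andbF.
have [<- _ _ _] := nb_words_fib n; rewrite addn0; congr (_ + _).
by apply: nb_words_eq => w; rewrite -[in RHS]fall_free_Low.
Qed.

(** The parity term of [fib_sum_sqr] is the increment of the floor. *)
Lemma sum_fib_sum n :
  \sum_(0 <= i < n.+1) fib_sum i + n.+2 %/ 2 = fib n * fib n.+1.
Proof.
elim: n => [|n IHn]; first by rewrite big_nat1 /fib_sum big_nil.
rewrite big_nat_recr //=.
have := fib_sum_sqr n.+1; rewrite /= in IHn *; nia.
Qed.

(** * Permutations determined by an order of the positions *)

Lemma card_perm_below n (s : 'S_n) m : m <= n -> #|[set k | s k < m]| = m.
Proof.
move=> le_mn.
have -> : [set k | s k < m] = s @^-1: [set v : 'I_n | v < m].
  by apply/setP => k; rewrite !inE.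
rewrite card_preimset; last exact: perm_inj.
have widenI : injective (widen_ord le_mn) by move=> u v [] /ord_inj.
rewrite -[RHS](card_ord m) -(card_imset _ widenI).
apply: eq_card => v; rewrite !inE; apply/idP/imsetP => [lt_vm | [u _ ->]].
  by exists (Ordinal lt_vm) => //; apply: val_inj.
exact: (ltn_ord u).
Qed.

(** The value of a permutation at [i] is the number of positions with a smaller
    value. *)
Lemma perm_order_inj n (s t : 'S_n) :
  (forall i j, s i < s j -> t i < t j) -> s = t.
Proof.
move=> st; apply/permP => i; apply: ord_inj.
rewrite -(card_perm_below s (ltnW (ltn_ord (s i)))).
rewrite -[RHS](card_perm_below t (ltnW (ltn_ord (t i)))).
apply: eq_card => k; rewrite !inE; apply/idP/idP => [/st // | lt_t].
case: ltngtP => // [/st | /ord_inj/perm_inj eq_ki]; first by lia.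
by rewrite eq_ki ltnn in lt_t.
Qed.

Section Rank.

Variables (n : nat) (f : 'I_n -> nat).
Hypothesis f_inj : injective f.

Fact rank_proof i : #|[set k | f k < f i]| < n.
Proof.
rewrite -[ltnRHS]card_ord -cardsT; apply/proper_card/properP; split=> //.
by exists i; rewrite !inE ?ltnn.
Qed.

Definition rank i : 'I_n := Ordinal (rank_proof i).

Lemma rank_lt i j : (rank i < rank j) = (f i < f j).
Proof.
have up a b : f a < f b -> rank a < rank b.
  move=> lt_ab; apply/proper_card/properP; split; last first.
    by exists a; rewrite !inE ?ltnn.
  by apply/subsetP => k; rewrite !inE => /ltn_trans; apply.
apply/idP/idP => [lt_ij | /up //].
case: ltngtP => // [/up | /f_inj eq_ij]; first by lia.
by rewrite eq_ij ltnn in lt_ij.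
Qed.

Fact rank_inj : injective rank.
Proof.
move=> i j eq_ij; apply: f_inj; apply/eqP.
by case: ltngtP => //; rewrite -rank_lt eq_ij ltnn.
Qed.

Definition rank_perm : 'S_n := perm rank_inj.

Lemma rank_permE i : rank_perm i = #|[set k | f k < f i]| :> nat.
Proof. by rewrite permE. Qed.

Lemma rank_perm_lt i j : (rank_perm i < rank_perm j) = (f i < f j).
Proof. by rewrite !permE rank_lt. Qed.

End Rank.

(** * The permutation of a word *)

Section WordPerm.

Variables (n : nat) (w : n.-tuple level).

Definition level_at (i : 'I_n) : level := nth High w i.

(** Compares positions first by colour, then from left to right, except for
    [Mid] from right to left; see [key_lt]. *)
Definition key (i : 'I_n) : nat :=
  height (level_at i) * n + (if level_at i is Mid then n.-1 - i else i).

Lemma key_lt i j : (key i < key j) =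
  match level_at i, level_at j with
  | Low, Low | High, High => i < j
  | Mid, Mid => j < i
  | x, y => height x < height y
  end.
Proof.
have := ltn_ord i; have := ltn_ord j; rewrite /key.
by case: (level_at i); case: (level_at j) => /=; lia.
Qed.

Fact key_inj : injective key.
Proof.
move=> i j eq_ij; have := key_lt i j; have := key_lt j i.
rewrite eq_ij ltnn; case: (level_at i); case: (level_at j) => //= ji ij;
  apply: ord_inj; lia.
Qed.

Definition word_perm : 'S_n := rank_perm key_inj.

Lemma word_perm_lt i j : (word_perm i < word_perm j) = (key i < key j).
Proof. exact: rank_perm_lt. Qed.

Definition cut h : nat := #|[set k | height (level_at k) < h]|.

(** The values increase with the colour, so the positions of height below [h]
    carry exactly the smallest values. *)
Lemma cutP h i : (word_perm i < cut h) = (height (level_at i) < h).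
Proof.
rewrite rank_permE /cut; case: (ltnP (height _) h) => hi.
  apply/proper_card/properP; split; last by exists i; rewrite !inE ?ltnn.
  apply/subsetP => k; rewrite !inE key_lt.
  by case: (level_at k) (level_at i) hi => -[] /=; lia.
rewrite ltnNge; apply/negbF/subset_leq_card/subsetP => k; rewrite !inE key_lt.
by case: (level_at k) (level_at i) hi => -[] /=; lia.
Qed.

End WordPerm.

(** * Descents *)

Lemma nth_oneline n (s : 'S_n) (i : 'I_n) : nth 0 (oneline s) i = (s i).+1.
Proof.
by rewrite /oneline (nth_map i) ?size_enum_ord // nth_ord_enum.
Qed.

Lemma size_oneline n (s : 'S_n) : size (oneline s) = n.
Proof. by rewrite size_map size_enum_ord. Qed.

Lemma std3_eq321 a b c : (std [:: a; b; c] == [:: 3; 2; 1]) = (b < a) && (c < b).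
Proof.
apply/eqP/andP => [[]|[lt_ba lt_cb]]; rewrite /std /= !leqnn; first by lia.
congr [:: _; _; _]; lia.
Qed.

Lemma avoids_321E (w : seq nat) :
  avoids_consecutive [:: 3; 2; 1] w = chain_free (fun a b => b < a) w.
Proof.
have factor i : i.+2 < size w -> take 3 (drop i w)
    = [:: nth 0 w i; nth 0 w i.+1; nth 0 w i.+2].
  move=> lt_i; have lt_i1 := ltnW lt_i; have lt_i0 := ltnW lt_i1.
  by rewrite (drop_nth 0 lt_i0) (drop_nth 0 lt_i1) (drop_nth 0 lt_i) /= take0.
rewrite /avoids_consecutive /contains_consecutive -all_predC.
apply/allP/(chain_freeP _ 0) => w_free i.
  move=> lt_i; rewrite -std3_eq321 -factor //.
  by apply: (w_free i); rewrite mem_iota /=; lia.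
rewrite mem_iota /= => lt_i; rewrite factor ?std3_eq321; last lia.
by apply: w_free; lia.
Qed.

(** Adjacent positions are compared by [key] in the way that [falls]
    describes, so the descents of the permutation are the falls of the word. *)
Lemma word_perm_avoids n (w : n.-tuple level) :
  avoids_consecutive [:: 3; 2; 1] (oneline (word_perm w)) = chain_free falls w.
Proof.
have step i : i.+1 < n ->
    (nth 0 (oneline (word_perm w)) i.+1 < nth 0 (oneline (word_perm w)) i)
    = falls (nth High w i) (nth High w i.+1).
  move=> lt_i; have lt_i' := ltnW lt_i.
  rewrite (nth_oneline _ (Ordinal lt_i)) (nth_oneline _ (Ordinal lt_i')).
  rewrite ltnS word_perm_lt key_lt /level_at /= /falls.
  by case: (nth High w i) => /=; case: (nth High w i.+1) => /=; lia.
rewrite avoids_321E.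
by apply/(chain_freeP _ 0)/(chain_freeP _ High) => + i;
  rewrite ?size_oneline ?size_tuple => w_free lt_i;
  [rewrite -!step | rewrite !step] => //; try lia;
  apply: w_free; rewrite ?size_oneline ?size_tuple.
Qed.

(** The left-hand side counts the maximal runs of consecutive indices at which
    [d] holds, each through its first index. *)
Lemma count_run_starts (d : pred nat) N :
  count (fun i => d i && ((i == 1) || ~~ d i.-1)) (iota 1 N) = 1 <->
  exists l r, [/\ 0 < l, l <= r <= N & forall i, 0 < i <= N -> d i = (l <= i <= r)].
Proof.
set start := fun i => _.
have countS M : count start (iota 1 M.+1) = count start (iota 1 M) + start M.+1.
  by rewrite -(addn1 M) iotaD count_cat /= add1n addn0 addn1.
split.
- have none M : count start (iota 1 M) = 0 -> forall i, 0 < i <= M -> d i = false.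
    elim: M => [|M IHM]; first by move=> _ i; lia.
    rewrite countS => cM i le_i.
    have [dM dN] : count start (iota 1 M) = 0 /\ start M.+1 = false by lia.
    have [|lt_Mi] := leqP i M; first by move=> ?; apply: IHM; lia.
    have -> : i = M.+1 by lia.
    apply: contraFF dN => dN; rewrite /start dN /=.
    by case: M {cM le_i lt_Mi dN} IHM dM => // M IHM dM; rewrite IHM //=; lia.
  elim: N => [|N IHN] //.
  rewrite countS.
  case startN: (start N.+1) => /=.
    rewrite addn1 => -[/none dN]; exists N.+1, N.+1; split=> //; first by lia.
    move=> i le_i; have [le_iN|lt_Ni] := leqP i N; first by rewrite dN; lia.
    have -> : i = N.+1 by lia.
    by case/andP: startN => ->; lia.
  rewrite addn0 => /IHN[l [r [l_gt0 le_lr dlr]]].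
  case dN: (d N.+1); last first.
    exists l, r; split=> //; first by lia.
    move=> i le_i; have [le_iN|lt_Ni] := leqP i N; first by apply: dlr; lia.
    have -> : i = N.+1 by lia.
    by rewrite dN; lia.
  have dN' : d N by move: startN; rewrite /start dN /=; case: (d N); lia.
  rewrite dlr in dN'; last lia.
  exists l, N.+1; split=> //; first by lia.
  move=> i le_i; have [le_iN|lt_Ni] := leqP i N; first by rewrite dlr; lia.
  have -> : i = N.+1 by lia.
  by rewrite dN; lia.
- case=> l [r [l_gt0 le_lr dlr]].
  rewrite (@eq_in_count _ _ (pred1 l)).
    by rewrite count_uniq_mem ?iota_uniq // mem_iota; case: leqP; lia.
  move=> i; rewrite mem_iota /start => le_i /=; rewrite dlr; last lia.
  case: (eqVneq i 1) => [-> | i_neq1] /=; first by lia.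
  by rewrite dlr; lia.
Qed.

(** The step from the value [v] to [v.+1], both counted from 1. *)
Definition inv_descent n (s : 'S_n) (v : nat) : bool :=
  letter (oneline s^-1%g) v.+1 < letter (oneline s^-1%g) v.

Lemma letter_inv n (s : 'S_n) (a : 'I_n) :
  letter (oneline s^-1%g) (s a).+1 = a.+1.
Proof. by rewrite /letter /= nth_oneline permK. Qed.

Lemma perm_value n (s : 'S_n) v : v < n -> exists a, s a = v :> nat.
Proof. by move=> lt_vn; exists (s^-1%g (Ordinal lt_vn)); rewrite permKV. Qed.

Lemma inv_descentE n (s : 'S_n) (a b : 'I_n) :
  s b = (s a).+1 :> nat -> inv_descent s (s b) = (b < a).
Proof. by move=> sb; rewrite /inv_descent {2}sb !letter_inv ltnS. Qed.

(** The left peaks of a word without repetitions are the first indices of its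
    runs of descents. *)
Lemma ilpk1P n (s : 'S_n) :
  ilpk s = 1 <->
  exists l r, [/\ 0 < l, l <= r <= n.-1 &
                forall i, 0 < i <= n.-1 -> inv_descent s i = (l <= i <= r)].
Proof.
rewrite -count_run_starts /ilpk /lpk.
rewrite (_ : count _ _ = count (fun i => inv_descent s i
                       && ((i == 1) || ~~ inv_descent s i.-1)) (iota 1 n.-1)) //.
apply: eq_in_count => i; rewrite mem_iota => le_i.
rewrite /is_left_peak /is_peak size_oneline.
have -> : 0 < i < n by lia.
have [-> | i_neq1] := eqVneq i 1; first by rewrite /= andbT.
rewrite orbF /= (_ : 1 < i < n) /=; last lia.
rewrite /inv_descent prednK; last lia.
have [|a sa] := @perm_value n s i.-1; first lia.
have [|b sb] := @perm_value n s i.-2; first lia.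
have -> : letter (oneline s^-1%g) i = a.+1.
  by rewrite -(letter_inv s) sa; congr letter; lia.
have -> : letter (oneline s^-1%g) i.-1 = b.+1.
  by rewrite -(letter_inv s) sb; congr letter; lia.
have neq_ab : a <> b :> nat by move=> /ord_inj eq_ab; rewrite eq_ab in sa; lia.
by rewrite andbC; congr (_ && _); lia.
Qed.

(** * Permutations whose inverse has one left peak *)

(** Let [a] and [b] be the positions of the values [v] and [v.+1], counted from
    1.  The claim is that [b] lies to the left of [a] iff [b] is not [Low] and [a] is not
    [High].  When both have the same colour this is the order within the
    colour.  Otherwise [a] is the last of its colour if it is [Low], [b] is
    the first of its colour if it is [High], and the sandwich condition puts
    the first [High] before every [Mid] before the last [Low]. *)
Lemma inv_descent_word n (w : n.-tuple level) v :
  sandwiched w -> 0 < v < n ->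
  inv_descent (word_perm w) v = (cut w 1 <= v <= cut w 2).
Proof.
case/sandwichedP => i0 [j0 []]; rewrite size_tuple => lt_ij wi0 wj0 mids lt_v.
have [lt_in lt_jn] : i0 < n /\ j0 < n by lia.
pose i := Ordinal lt_in; pose j := Ordinal lt_jn.
have [|b sb] := @perm_value n (word_perm w) v; first lia.
have [|a sa] := @perm_value n (word_perm w) v.-1; first lia.
have sab : word_perm w b = (word_perm w a).+1 :> nat by lia.
rewrite -[in LHS]sb (inv_descentE sab).
have -> : (v <= cut w 2) = (height (level_at w a) < 2).
  by rewrite -cutP sa; lia.
have -> : (cut w 1 <= v) = (0 < height (level_at w b)).
  by rewrite leqNgt -sb cutP ltnS lt0n leqn0.
have last_low : key w j < key w b -> ~~ (key w a < key w j).
  by rewrite -!word_perm_lt sab; lia.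
have first_high : key w a < key w i -> ~~ (key w i < key w b).
  by rewrite -!word_perm_lt sab; lia.
have : key w a < key w b by rewrite -word_perm_lt sab.
have midP k : height (level_at w k) == 1 -> i0 < k < j0.
  move=> k_mid; apply: mids => //; rewrite -[LHS]/(level_at w k).
  by case: (level_at w k) k_mid.
move: last_low first_high (midP a) (midP b); rewrite !key_lt.
rewrite [level_at w i]wi0 [level_at w j]wj0.
case: (level_at w a); case: (level_at w b) => //= lastP firstP ma mb ab; lia.
Qed.

Lemma sandwiched_cuts n (w : n.-tuple level) :
  sandwiched w -> 0 < cut w 1 /\ cut w 1 <= cut w 2 <= n.-1.
Proof.
case/sandwichedP => i0 [j0 []]; rewrite size_tuple => lt_ij wi0 wj0 _.
have [lt_in lt_jn] : i0 < n /\ j0 < n by lia.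
have := cutP w 1 (Ordinal lt_jn); rewrite /level_at /= wj0 /= => cut1.
have := cutP w 2 (Ordinal lt_in); rewrite /level_at /= wi0 /= => cut2.
split; first by lia.
apply/andP; split; last by have := ltn_ord (word_perm w (Ordinal lt_in)); lia.
by apply/subset_leq_card/subsetP => k; rewrite !inE; lia.
Qed.

Lemma ilpk_word_perm n (w : n.-tuple level) : sandwiched w -> ilpk (word_perm w) = 1.
Proof.
move=> sw; apply/ilpk1P; exists (cut w 1), (cut w 2).
have [cut_gt0 cut_le] := sandwiched_cuts sw; split=> // v le_v.
by apply: inv_descent_word => //; lia.
Qed.

(** The cuts are the ends of the interval of inverse descents, so they can be
    read off the permutation, and they give the colour of each value. *)
Lemma word_perm_inj n :
  {in [set w : n.-tuple level | sandwiched w] &, injective (@word_perm n)}.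
Proof.
move=> w1 w2; rewrite !inE => sw1 sw2 eq_w.
have desc v : 0 < v < n -> (cut w1 1 <= v <= cut w1 2) = (cut w2 1 <= v <= cut w2 2).
  by move=> lt_v; rewrite -!inv_descent_word // eq_w.
have [gt1 le1] := sandwiched_cuts sw1; have [gt2 le2] := sandwiched_cuts sw2.
have d1 := desc (cut w1 1); have d2 := desc (cut w2 1).
have d3 := desc (cut w1 2); have d4 := desc (cut w2 2).
have cut1 : cut w1 1 = cut w2 1 by lia.
have cut2 : cut w1 2 = cut w2 2 by lia.
apply: eq_from_tnth => i; rewrite !(tnth_nth High).
have := cutP w1 1 i; have := cutP w1 2 i; have := cutP w2 1 i; have := cutP w2 2 i.
rewrite eq_w cut1 cut2 /level_at => -> -> .
by case: (nth High w1 i); case: (nth High w2 i).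
Qed.

Definition layers n (s : 'S_n) l r : n.-tuple level :=
  [tuple if s i < l then Low else if s i < r then Mid else High | i < n].

Lemma level_at_layers n (s : 'S_n) l r i :
  level_at (layers s l r) i = if s i < l then Low else if s i < r then Mid else High.
Proof. by rewrite /level_at -tnth_nth tnth_mktuple. Qed.

Lemma chain_leq_in (e : rel nat) (g : nat -> nat) lo hi :
  reflexive e -> transitive e ->
  (forall v, lo <= v -> v.+1 < hi -> e (g v) (g v.+1)) ->
  forall u v, lo <= u <= v -> v < hi -> e (g u) (g v).
Proof.
move=> e_refl e_trans e_step u v; elim: v => [|v IHv] le_uv lt_v.
  by have -> : u = 0 by lia.
have [-> // | neq_u] := eqVneq u v.+1.
by apply: (e_trans (g v)); [apply: IHv | apply: e_step]; lia.
Qed.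

Section Layers.

Variables (n : nat) (s : 'S_n) (l r : nat).
Hypotheses (l_gt0 : 0 < l) (le_lr : l <= r <= n.-1).
Hypothesis descE : forall i, 0 < i <= n.-1 -> inv_descent s i = (l <= i <= r).

(** The steps between values on one side of the interval of descents are all
    ascents; the bounds [lo] and [hi] cover the two sides at once. *)
Lemma inv_increasing lo hi (a b : 'I_n) :
  hi <= l \/ r <= lo -> lo <= s a -> s a < s b -> s b < hi -> a < b.
Proof.
move=> out le_a lt_ab lt_b.
have := @chain_leq_in leq (fun v => letter (oneline s^-1%g) v.+1) lo (minn hi n)
          leqnn (@leq_trans) _ (s a) (s b).
rewrite !letter_inv => le_ab; have lt_bn := ltn_ord (s b).
have {le_ab} : a.+1 <= b.+1.
  apply: le_ab => [v le_v lt_v||]; [|lia|lia].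
  by have := descE (i := v.+1); rewrite /inv_descent; lia.
by rewrite ltnS leq_eqVlt => /orP[/eqP/ord_inj eq_ab | //]; rewrite eq_ab ltnn in lt_ab.
Qed.

(** The descents [l, ..., r] join the values from [l] to [r.+1], counted from 1,
    so the decreasing run includes one value of each outer colour. *)
Lemma inv_decreasing (a b : 'I_n) :
  l <= (s a).+1 -> s a < s b -> s b <= r -> b < a.
Proof.
move=> le_a lt_ab lt_b.
have := @chain_leq_in geq (fun v => letter (oneline s^-1%g) v.+1) l.-1 r.+1
          leqnn (fun x y z le_yx le_zx => leq_trans le_zx le_yx) _ (s a) (s b).
rewrite !letter_inv => le_ab.
have {le_ab} : b.+1 <= a.+1.
  apply: le_ab => [v le_v lt_v||]; [|lia|lia].
  by have := descE (i := v.+1); rewrite /inv_descent /=; lia.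
by rewrite ltnS leq_eqVlt => /orP[/eqP/ord_inj eq_ab | //]; rewrite eq_ab ltnn in lt_ab.
Qed.

(** The bounds are the last [Low], which has the value [l], and the first
    [High], which has the value [r.+1] (counted from 1): these are the ends of
    the decreasing run of positions. *)
Lemma layers_sandwiched : sandwiched (layers s l r).
Proof.
have [|i si] := @perm_value n s r; first lia.
have [|j sj] := @perm_value n s l.-1; first lia.
apply/sandwichedP; exists i, j; rewrite size_tuple.
have lt_ij : i < j by apply: inv_decreasing; lia.
split=> [||| k0 lt_k].
- by rewrite lt_ij /=.
- by have := level_at_layers s l r i; rewrite /level_at => ->; rewrite !ifN //; lia.
- by have := level_at_layers s l r j; rewrite /level_at => ->; rewrite ifT //; lia.
- have [k ->] : exists k : 'I_n, k0 = k by exists (Ordinal lt_k).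
  have := level_at_layers s l r k; rewrite /level_at => ->.
  case: ltnP => // le_k; case: ltnP => // lt_kr _.
  by have := @inv_decreasing k i; have := @inv_decreasing j k; lia.
Qed.

Lemma word_perm_layers : word_perm (layers s l r) = s.
Proof.
apply/esym/perm_order_inj => a b lt_ab; rewrite word_perm_lt key_lt !level_at_layers.
case: (ltnP (s a) l) => al; case: (ltnP (s b) l) => bl; try lia.
- by apply: (@inv_increasing 0 l) => //; left.
- by case: ifP.
case: (ltnP (s a) r) => ar; case: (ltnP (s b) r) => br //; try lia.
- by apply: inv_decreasing; lia.
- by apply: (@inv_increasing r n) => //; right.
Qed.

End Layers.

Lemma word_perm_onto n (s : 'S_n) :
  ilpk s = 1 -> exists2 w : n.-tuple level, sandwiched w & word_perm w = s.
Proof.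
case/ilpk1P => l [r [l_gt0 le_lr descE]]; exists (layers s l r).
  exact: layers_sandwiched.
exact: word_perm_layers.
Qed.

Theorem theorem2 (n : nat) (hn : 1 <= n) :
  #|[set pi : 'S_n | avoids_consecutive [:: 3; 2; 1] (oneline pi)
                     && (ilpk pi == 1)]|
    = \sum_(1 <= i < n) \sum_(1 <= k < i.+1) fib k.-1 * fib k
  /\ ((\sum_(1 <= i < n) \sum_(1 <= k < i.+1) fib k.-1 * fib k)%N%:Z
      = (fib n.-1 * fib n)%N%:Z - (n.+1 %/ 2)%N%:Z)%R.
Proof.
have sum_from0 : \sum_(1 <= i < n) \sum_(1 <= k < i.+1) fib k.-1 * fib k
                 = \sum_(0 <= i < n) fib_sum i.
  by rewrite [RHS]big_ltn // fib_sum0.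
rewrite sum_from0; split; last first.
  by case: n hn {sum_from0} => // n _; rewrite -sum_fib_sum PoszD GRing.addrK.
rewrite -nb_words_sandwiched /nb_words -(card_in_imset (f := @word_perm n)); last first.
  move=> w1 w2; rewrite !inE => /andP[_ sw1] /andP[_ sw2].
  by apply: word_perm_inj; rewrite inE.
apply: eq_card => s; rewrite inE; apply/andP/imsetP => [[s_av /eqP /word_perm_onto] | [w]].
  by case=> w sw eq_s; exists w => //; rewrite inE sw -word_perm_avoids eq_s s_av.
rewrite inE => /andP[w_free sw] ->.
by rewrite word_perm_avoids w_free ilpk_word_perm.
Qed.
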